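(* Let $\boldsymbol{x}_1,\ldots,\boldsymbol{x}_b$ be a collection of vector-valued random variables dependent on some random variable $B$, with finite variance $\mathrm{tr}\,\mathbb{V}[\boldsymbol{x}_i]<\infty$ for all $i$, and suppose there is $\rho\in[0,1]$ such that for all $i\ne j$, $$\mathrm{tr}\,\mathrm{Cov}(\boldsymbol{x}_i,\boldsymbol{x}_j)\le\rho\,\sqrt{\mathrm{tr}\,\mathbb{V}[\boldsymbol{x}_i]}\,\sqrt{\mathrm{tr}\,\mathbb{V}[\boldsymbol{x}_j]}.$$ Then the expected variance of the sum conditioned on $B$ is bounded as $$\mathbb{E}\Big[\mathrm{tr}\,\mathbb{V}\Big[\sum_{i=1}^b\boldsymbol{x}_i\,\Big|\,B\Big]\Big]\le\rho\,\mathbb{V}[S]+\rho\,(\mathbb{E}S)^2+(1-\rho)\,\mathbb{E}[V],$$ where $S=\sum_{i=1}^b\sqrt{\mathrm{tr}\,\mathbb{V}[\boldsymbol{x}_i\mid B]}$ and $V=\sum_{i=1}^b\mathrm{tr}\,\mathbb{V}[\boldsymbol{x}_i\mid B]$. Equality holds when equality holds in the assumed correlation inequality.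
   Context: $\mathrm{tr}\,\mathbb{V}[\boldsymbol{x}]=\mathbb{E}\|\boldsymbol{x}-\mathbb{E}\boldsymbol{x}\|_2^2$, $\mathrm{tr}\,\mathrm{Cov}(\boldsymbol{x},\boldsymbol{y})=\mathbb{E}\langle\boldsymbol{x}-\mathbb{E}\boldsymbol{x},\boldsymbol{y}-\mathbb{E}\boldsymbol{y}\rangle$, and $\mathrm{tr}\,\mathbb{V}[\boldsymbol{x}\mid B]=\mathbb{E}[\|\boldsymbol{x}-\mathbb{E}[\boldsymbol{x}\mid B]\|_2^2\mid B]$.
   Formalization: The correlation inequality (and its equality case) is assumed for the covariances and variances conditioned on B, almost surely, instead of the unconditional ones; with unconditional ones the claim fails, e.g. for x_1=e+s, x_2=e-s, B=s with independent signs e, s and rho=0. *)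

(* Defs.v *)
From mathcomp Require Export all_boot all_order all_algebra.
From mathcomp Require Export all_classical all_reals all_analysis.

Set Implicit Arguments.
Unset Strict Implicit.
Unset Printing Implicit Defensive.

Import Order.TTheory GRing.Theory Num.Theory.
Import numFieldNormedType.Exports.

Local Open Scope classical_set_scope.
Local Open Scope ring_scope.

Definition inner (R : realType) (n : nat) (u v : 'rV[R]_n) : R :=
  \sum_(k < n) u 0 k * v 0 k.

(* The Euclidean norm; the library norm `|u| on 'rV[R]_n is the sup norm. *)
Definition norm2 (R : realType) (n : nat) (u : 'rV[R]_n) : R :=
  Num.sqrt (inner u u).

Section random_vectors.
Context {d : measure_display} {T : measurableType d} {R : realType}.
Variable P : probability T R.

(* Borel measurability of a map into R^n, stated coordinatewise. *)
Definition random_vector {n : nat} (x : T -> 'rV[R]_n) : Prop :=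
  forall k : 'I_n, measurable_fun setT (fun w => x w 0 k).

Definition mean {n : nat} (x : T -> 'rV[R]_n) : 'rV[R]_n :=
  \row_k fine ('E_P[fun w => (x w 0 k)%R])%E.

(* Valued in \bar R: +oo exactly when the random vector x is not square
   integrable (including the case where x has no mean). *)
Definition trVar {n : nat} (x : T -> 'rV[R]_n) : \bar R :=
  ('E_P[fun w => (norm2 (x w - mean x) ^+ 2)%R])%E.

Section conditioning.
Context {d' : measure_display} {T' : measurableType d'}.
Variable B : {RV P >-> T'}.

(* Y is a version of E[X | sigma(B)]. *)
Definition is_condE (X Y : T -> R) : Prop :=
  [/\ measurable_fun setT (Y : g_sigma_algebra_preimageType B -> R),
      P.-integrable setT (EFin \o Y) &
      forall A : set T, g_sigma_algebra_preimage B A ->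
        (\int[P]_(w in A) (Y w)%:E = \int[P]_(w in A) (X w)%:E)%E].

(* A chosen version of E[X | B], and the junk value 0 if there is none (which
   does not happen for integrable X). Versions agree only P-almost surely, so
   pointwise facts about condE are meaningful only up to P-null sets. *)
Definition condE (X : T -> R) : T -> R := xget (cst 0) [set Y | is_condE X Y].

Definition condMean {n : nat} (x : T -> 'rV[R]_n) : T -> 'rV[R]_n :=
  fun w => \row_k condE (fun w' => x w' 0 k) w.

(* tr V[x | B] = E[ ||x - E[x|B]||_2^2 | B ] *)
Definition trCondVar {n : nat} (x : T -> 'rV[R]_n) : T -> R :=
  condE (fun w => norm2 (x w - condMean x w) ^+ 2).

(* tr Cov(x, y | B) = E[ <x - E[x|B], y - E[y|B]> | B ]: the trace covariance
   computed under the law conditioned on B. *)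
Definition trCondCov {n : nat} (x y : T -> 'rV[R]_n) : T -> R :=
  condE (fun w => inner (x w - condMean x w) (y w - condMean y w)).

(* "tr Cov(x_i, x_j) <= rho sqrt(tr V[x_i]) sqrt(tr V[x_j]) for i != j", read
   under the law given B, i.e. for almost every value of B. The same bound on
   unconditional covariances does not suffice for a bound on conditional
   variances: for independent signs e and s with B = s, the variables e + s and
   e - s are uncorrelated, but their sum has conditional variance 4 while their
   conditional variances are 1 and 1. *)
Definition corr_le {n b : nat} (x : 'I_b -> T -> 'rV[R]_n) (rho : R) : Prop :=
  forall i j : 'I_b, i != j ->
    {ae P, forall w, trCondCov (x i) (x j) w <=
      rho * Num.sqrt (trCondVar (x i) w) * Num.sqrt (trCondVar (x j) w)}.

Definition corr_eq {n b : nat} (x : 'I_b -> T -> 'rV[R]_n) (rho : R) : Prop :=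
  forall i j : 'I_b, i != j ->
    {ae P, forall w, trCondCov (x i) (x j) w =
      rho * Num.sqrt (trCondVar (x i) w) * Num.sqrt (trCondVar (x j) w)}.

Definition sumCondStd {n b : nat} (x : 'I_b -> T -> 'rV[R]_n) : T -> R :=
  fun w => \sum_(i < b) Num.sqrt (trCondVar (x i) w).

Definition sumCondVar {n b : nat} (x : 'I_b -> T -> 'rV[R]_n) : T -> R :=
  fun w => \sum_(i < b) trCondVar (x i) w.

End conditioning.
End random_vectors.

(* Main.v *)
(* With y_i = x_i - E[x_i | B], linearity of conditional expectation gives
   tr V[sum_i x_i | B] = sum_(i, j) E[<y_i, y_j> | B] almost surely. The diagonal
   terms are the conditional variances v_i, and the others are at most
   rho sqrt(v_i) sqrt(v_j), so the double sum is at most rho S^2 + (1 - rho) V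
   pointwise; now take expectations and use E[S^2] = V[S] + (E S)^2.
   All terms are integrable because conditional expectation maps L^2 to L^2.
   A version of E[X | B] is g o B, where g is the Radon-Nikodym derivative of
   the image by B of the charge A |-> E[X 1_A] with respect to the law of B. *)
Require Import Defs.
From mathcomp Require Import measurable_realfun ring.

Set Implicit Arguments.
Unset Strict Implicit.
Unset Printing Implicit Defensive.

Import Order.TTheory GRing.Theory Num.Theory.
Import numFieldNormedType.Exports.

Local Open Scope classical_set_scope.
Local Open Scope ring_scope.

(** * Comparison of signed integrals and a criterion for square integrability *)

Lemma ae_le_integral d (T : measurableType d) (R : realType)
    (mu : {measure set T -> \bar R}) (D : set T) (f g : T -> \bar R) :
  measurable D -> mu.-integrable D f -> mu.-integrable D g ->
  {ae mu, forall x, D x -> (f x <= g x)%E} ->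
  (\int[mu]_(x in D) f x <= \int[mu]_(x in D) g x)%E.
Proof.
move=> mD intf intg fg.
have mf := measurable_int mu intf; have mg := measurable_int mu intg.
(* An almost sure bound f <= g raises positive parts and lowers negative parts, so each part reduces
   to the comparison of nonnegative integrands. *)
rewrite integralE [leRHS]integralE; apply: leeB.
- apply: ae_ge0_le_integral => //; [exact: measurable_funepos..|].
  apply: filterS fg => x fgx Dx.
  by rewrite !funeposE ge_max !le_max lexx orbT andbT (fgx Dx).
- apply: ae_ge0_le_integral => //; [exact: measurable_funeneg..|].
  apply: filterS fg => x fgx Dx.
  by rewrite !funenegE ge_max !le_max lexx orbT andbT leeN2 (fgx Dx).
Qed.

Lemma Lfun2P d (T : measurableType d) (R : realType)
    (mu : {measure set T -> \bar R}) (f : T -> R) :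
  measurable_fun setT f -> (\int[mu]_x (f x ^+ 2)%:E < +oo)%E ->
  f \in Lfun mu 2%:E.
Proof.
move=> mf foo; rewrite inE; apply/andP; split; rewrite inE//=.
rewrite /finite_norm unlock poweR_lty//.
under eq_integral do rewrite /= powR_mulrn// real_normK ?num_real//.
exact: foo.
Qed.

(** * Existence, uniqueness, linearity and square integrability of conditional expectations *)

Section conditional_expectation.
Context d d' (T : measurableType d) (T' : measurableType d') (R : realType).
Variables (P : probability T R) (B : {RV P >-> T'}).
Implicit Types X Y : T -> R.

Lemma sigma_preimage_measurable (A : set T) :
  g_sigma_algebra_preimage B A -> measurable A.
Proof. by case=> C mC <-; rewrite setTI; exact: measurable_funPTI. Qed.

Lemma sigma_preimage_measurable_fun Y :
  measurable_fun setT (Y : g_sigma_algebra_preimageType B -> R) ->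
  measurable_fun setT Y.
Proof.
move=> mY _ A mA; apply: sigma_preimage_measurable.
exact: (mY measurableT A mA).
Qed.

Lemma is_condE_L1 X Y : is_condE B X Y -> Y \in Lfun P 1.
Proof. by case=> _ ? _; exact/Lfun1_integrable. Qed.

Lemma Lfun1_integrableS X (A : set T) : X \in Lfun P 1 -> measurable A ->
  P.-integrable A (EFin \o X).
Proof.
move=> /Lfun1_integrable iX mA; exact: (integrableS measurableT).
Qed.

Lemma is_condE_ex X : X \in Lfun P 1 -> exists Y, is_condE B X Y.
Proof.
move=> /Lfun1_integrable iX.
have mB : measurable_fun setT B by [].
have mX := measurable_int P iX.
(* The canonical charge on a pushforward takes the measurability of [B] as an
   argument, which [nu_] abstracts over. *)
pose nu_ : {charge set T' -> \bar R} := pushforward (induced_charge iX) B.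
pose nu := nu_ mB.
have nuE A : nu A = (\int[P]_(w in B @^-1` A) (X w)%:E)%E by [].
pose mu := distribution P B.
(* A set that is null for the law of [B] has a [P]-null preimage, over which [X] integrates to 0. *)
have numu : nu `<< mu.
  apply/null_content_dominatesP => A mA muA; rewrite nuE.
  apply: null_set_integral => //; first exact: measurable_funPTI.
  exact: measurable_funTS.
pose g := Radon_Nikodym nu mu.
have ig : mu.-integrable setT g by exact: Radon_Nikodym_integrable.
have mg := measurable_int mu ig.
have gfin y : g y \is a fin_num by exact: Radon_Nikodym_fin_num.
have YE w : (fine (g (B w)))%:E = g (B w) by rewrite fineK.
have igB : P.-integrable setT (g \o B).
  apply/integrableP; split; first exact: measurableT_comp.
  have /integrableP[_] := ig.
  by rewrite ge0_integral_distribution//; exact: measurableT_comp.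
exists (fun w => fine (g (B w))); split.
(* Factoring through [B] is what gives measurability for sigma(B): preimages of Borel sets are
   [B]-preimages of measurable sets. *)
- move=> _ A mA; exists ((fun y => fine (g y)) @^-1` A) => //.
  rewrite -[X in measurable X]setTI.
  by apply: (measurableT_comp (fine_measurable measurableT) mg).
- by apply: eq_integrable igB => // w _ /=; rewrite YE.
- move=> _ [A mA <-]; rewrite setTI -nuE.
  rewrite (Radon_Nikodym_integral numu mA) -/g integral_pushforward//.
    by apply: eq_integral => w _ /=; rewrite YE.
  by apply: (integrableS measurableT) => //; exact: measurable_funPTI.
Qed.

Lemma condEP X : X \in Lfun P 1 -> is_condE B X (condE B X).
Proof. by move=> /is_condE_ex; exact: xgetPex. Qed.

(** The set [A] where Y' < Y lies in sigma(B), so the integral of Y - Y' over it equals that of X -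
    X', which is at most 0. The integrand Y - Y' is positive on [A], hence [A] is null. *)
Lemma is_condE_ae_le X X' Y Y' : X \in Lfun P 1 -> X' \in Lfun P 1 ->
  is_condE B X Y -> is_condE B X' Y' ->
  {ae P, forall w, X w <= X' w} -> {ae P, forall w, Y w <= Y' w}.
Proof.
move=> iX iX' XY XY' leXX'.
have iY := is_condE_L1 XY; have iY' := is_condE_L1 XY'.
case: XY => mY _ YE; case: XY' => mY' _ YE'.
pose A := [set w | Y' w < Y w].
have sA : g_sigma_algebra_preimage B A.
  have := measurable_fun_ltr mY' mY measurableT (I : measurable [set true]).
  by rewrite setTI.
have mA := sigma_preimage_measurable sA.
pose D w := Y w - Y' w.
have mD : measurable_fun A (EFin \o D).
  apply/measurable_EFinP/measurable_funTS.
  by apply: measurable_funB; apply: sigma_preimage_measurable_fun.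
have D0 : (\int[P]_(w in A) `|(EFin \o D) w|)%E = 0.
  apply/eqP; rewrite eq_le integral_ge0// andbT.
  under eq_integral => w /[!inE] Aw.
    rewrite /= ger0_norm ?subr_ge0 ?(ltW Aw)// EFinB; over.
  rewrite /= integralB_EFin//; [|exact: Lfun1_integrableS..].
  rewrite YE// YE'// lee_subel_addr ?add0e//.
  apply: ae_le_integral => //; [exact: Lfun1_integrableS..|].
  by apply: filterS leXX' => w ? _; rewrite lee_fin.
move/(ae_eq_integral_abs P mA mD) : D0; apply: filterS => w Dw.
rewrite leNgt; apply/negP => Aw.
by have [] := Dw Aw; apply/eqP; rewrite subr_eq0 gt_eqF.
Qed.

(** Almost sure uniqueness: it carries identities proved for an explicit version over to the version
    chosen by [condE]. *)
Lemma is_condE_ae_eq X X' Y Y' : X \in Lfun P 1 -> X' \in Lfun P 1 ->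
  is_condE B X Y -> is_condE B X' Y' ->
  {ae P, forall w, X w = X' w} -> {ae P, forall w, Y w = Y' w}.
Proof.
move=> iX iX' XY XY' XX'.
have le1 : {ae P, forall w, Y w <= Y' w}.
  by apply: is_condE_ae_le XY XY' _ => //; apply: filterS XX' => w ->.
have le2 : {ae P, forall w, Y' w <= Y w}.
  by apply: is_condE_ae_le XY' XY _ => //; apply: filterS XX' => w ->.
by apply: filterS2 le1 le2 => w ? ?; apply/eqP; rewrite eq_le; apply/andP.
Qed.

Lemma is_condE_cst (c : R) : is_condE B (cst c) (cst c).
Proof. by split=> //; exact: finite_measure_integrable_cst. Qed.

(** Linearity is proved for the relation [is_condE], where pointwise sums of versions are again
    versions; null sets enter only on passing to [condE]. *)
Lemma is_condED X X' Y Y' : X \in Lfun P 1 -> X' \in Lfun P 1 ->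
  is_condE B X Y -> is_condE B X' Y' ->
  is_condE B (fun w => X w + X' w) (fun w => Y w + Y' w).
Proof.
move=> iX iX' XY XY'.
have iY := is_condE_L1 XY; have iY' := is_condE_L1 XY'.
case: XY => mY _ YE; case: XY' => mY' _ YE'; split.
- exact: measurable_funD.
- by apply/Lfun1_integrable; rewrite rpredD.
- move=> A sA; have mA := sigma_preimage_measurable sA.
  under eq_integral do rewrite EFinD.
  under [RHS]eq_integral do rewrite EFinD.
  rewrite !integralD//; [|exact: Lfun1_integrableS..].
  by rewrite YE// YE'.
Qed.

Lemma is_condEZ (a : R) X Y : X \in Lfun P 1 ->
  is_condE B X Y -> is_condE B (fun w => a * X w) (fun w => a * Y w).
Proof.
move=> iX XY.
have iY := is_condE_L1 XY.
case: XY => mY _ YE; split.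
- exact: measurable_funM.
- by apply/Lfun1_integrable; rewrite (rpredZ a iY).
- move=> A sA; have mA := sigma_preimage_measurable sA.
  under eq_integral do rewrite EFinM.
  under [RHS]eq_integral do rewrite EFinM.
  rewrite !integralZl//; [|exact: Lfun1_integrableS..].
  by rewrite YE.
Qed.

Lemma is_condE_sum I (s : seq I) (X Y : I -> T -> R) :
  (forall i, X i \in Lfun P 1) -> (forall i, is_condE B (X i) (Y i)) ->
  is_condE B (fun w => \sum_(i <- s) X i w) (fun w => \sum_(i <- s) Y i w).
Proof.
move=> iX XY; elim: s => [|i s IHs].
  under eq_fun do rewrite big_nil.
  under [X in is_condE _ _ X]eq_fun do rewrite big_nil.
  exact: is_condE_cst.
under eq_fun do rewrite big_cons.
under [X in is_condE _ _ X]eq_fun do rewrite big_cons.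
apply: is_condED => //.
by rewrite -[X in X \in _]fct_sumE rpred_sum.
Qed.

Lemma condE_L1 X : X \in Lfun P 1 -> condE B X \in Lfun P 1.
Proof. by move=> /condEP/is_condE_L1. Qed.

Lemma condE_ge0 X : X \in Lfun P 1 -> (forall w, 0 <= X w) ->
  {ae P, forall w, 0 <= condE B X w}.
Proof.
move=> iX X0.
apply: is_condE_ae_le (is_condE_cst 0) (condEP iX) _ => //.
  exact: Lfun_cst.
exact: aeW.
Qed.

Lemma condE_sum I (s : seq I) (X : I -> T -> R) :
  (forall i, X i \in Lfun P 1) ->
  {ae P, forall w,
    condE B (fun w => \sum_(i <- s) X i w) w = \sum_(i <- s) condE B (X i) w}.
Proof.
move=> iX.
have iS : (fun w => \sum_(i <- s) X i w) \in Lfun P 1.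
  by rewrite -[X in X \in _]fct_sumE rpred_sum.
apply: is_condE_ae_eq (condEP iS) (is_condE_sum s iX _) _ => //.
  by move=> i; exact: condEP.
exact: aeW.
Qed.

Lemma Lfun21 X : X \in Lfun P 2%:E -> X \in Lfun P 1.
Proof. by apply: Lfun_subset12; exact: fin_num_measure. Qed.

Lemma Lfun2_sqr X : X \in Lfun P 2%:E -> (fun w => X w ^+ 2) \in Lfun P 1.
Proof. by move=> /Lfun2_integrable_sqr/Lfun1_integrable. Qed.

(* The square is the supremum of its tangents [2 q t - q ^ 2] at rational [q],
   and countably many almost sure inequalities hold simultaneously. *)
Lemma condE_sqr_le X : X \in Lfun P 2%:E ->
  {ae P, forall w, condE B X w ^+ 2 <= condE B (fun w => X w ^+ 2) w}.
Proof.
move=> X2; have X1 := Lfun21 X2; have XX1 := Lfun2_sqr X2.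
(* An enumeration of the rationals; indices that encode no rational give 0. *)
pose q n : R := ratr (odflt 0 (unpickle n : option rat)).
have tangent n : {ae P, forall w,
    2 * q n * condE B X w + - q n ^+ 2 <= condE B (fun w => X w ^+ 2) w}.
  have X1' : (fun w => 2 * q n * X w) \in Lfun P 1 by rewrite (rpredZ _ X1).
  have C1 := Lfun_cst P (- q n ^+ 2) 1.
  have XC := is_condED X1' C1 (is_condEZ (2 * q n) X1 (condEP X1))
    (is_condE_cst (- q n ^+ 2)).
  apply: is_condE_ae_le XC (condEP XX1) _ => //.
    by rewrite rpredD.
  apply: aeW => w /=; rewrite -subr_ge0.
  have -> : X w ^+ 2 - (2 * q n * X w + - q n ^+ 2) = (X w - q n) ^+ 2 by ring.
  exact: sqr_ge0.
have := ae_foralln tangent; apply: filterS => w tgt.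
set y := condE B X w in tgt *; set z := condE B _ w in tgt *.
rewrite leNgt; apply/negP; rewrite -subr_gt0 => zy.
(* If z < y ^ 2, a rational r this close to y satisfies (r - y) ^ 2 < y ^ 2 - z, so the tangent at r
   already exceeds z at y. *)
have [|r] := @rat_in_itvoo R y (y + Num.sqrt (y ^+ 2 - z)).
  by rewrite ltrDl sqrtr_gt0.
rewrite in_itv/= => /andP[yr ry].
have := tgt (pickle r); rewrite /q pickleK/= leNgt => /negP; apply.
rewrite -subr_gt0.
have -> : 2 * ratr r * y + - ratr r ^+ 2 - z = y ^+ 2 - z - (ratr r - y) ^+ 2.
  by ring.
rewrite subr_gt0 -[ltRHS]sqr_sqrtr ?(ltW zy)// ltr_pXn2r// ?nnegrE ?sqrtr_ge0//.
- by rewrite ltrBlDl.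
- by rewrite subr_ge0 ltW.
Qed.

(** By the conditional Jensen inequality above, the square is dominated by E[X ^ 2 | B], which is
    integrable. *)
Lemma condE_L2 X : X \in Lfun P 2%:E -> condE B X \in Lfun P 2%:E.
Proof.
move=> X2; have X1 := Lfun21 X2; have XX1 := Lfun2_sqr X2.
have /condE_L1/Lfun1_integrable/(measurable_int P)/measurable_EFinP mC := X1.
have /condE_L1/Lfun1_integrable/integrableP[mZ Zoo] := XX1.
apply: Lfun2P => //; apply: le_lt_trans Zoo.
apply: ae_ge0_le_integral => //.
- by move=> w _; rewrite lee_fin sqr_ge0.
- by apply/measurable_EFinP; exact: measurable_funX.
- exact: measurableT_comp.
- have := condE_sqr_le X2; apply: filterS => w le_w _ /=.
  by rewrite lee_fin (le_trans le_w)// ler_norm.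
Qed.

End conditional_expectation.

(** * Square-integrable vectors and traces of conditional covariances *)

Section trace_covariance.
Context d d' (T : measurableType d) (T' : measurableType d') (R : realType).
Variables (P : probability T R) (B : {RV P >-> T'}).

Lemma norm2_sqr n (u : 'rV[R]_n) : norm2 u ^+ 2 = inner u u.
Proof.
by rewrite sqr_sqrtr// sumr_ge0// => k _; rewrite -expr2 sqr_ge0.
Qed.

Lemma inner_suml n I (s : seq I) (u : I -> 'rV[R]_n) (v : 'rV[R]_n) :
  inner (\sum_(i <- s) u i) v = \sum_(i <- s) inner (u i) v.
Proof.
rewrite exchange_big; apply: eq_bigr => k _.
by rewrite summxE mulr_suml.
Qed.

Lemma innerC n (u v : 'rV[R]_n) : inner u v = inner v u.
Proof. by apply: eq_bigr => k _; rewrite mulrC. Qed.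

Lemma inner_sum n I (s : seq I) (u v : I -> 'rV[R]_n) :
  inner (\sum_(i <- s) u i) (\sum_(i <- s) v i) =
  \sum_(i <- s) \sum_(j <- s) inner (u i) (v j).
Proof.
rewrite inner_suml; apply: eq_bigr => i _.
by rewrite innerC inner_suml; apply: eq_bigr => j _; rewrite innerC.
Qed.

Definition square_integrable n (x : T -> 'rV[R]_n) :=
  forall k, (fun w => x w 0 k) \in Lfun P 2%:E.

(** Each squared centred coordinate is at most the squared norm, and adding back the constant [m]
    stays in L^2. Through [fine], [m] is a real number even before the coordinate is known to be
    integrable. *)
Lemma trVar_square_integrable n (x : T -> 'rV[R]_n) :
  random_vector x -> (trVar P x < +oo)%E -> square_integrable x.
Proof.
move=> x_rv x_var k; pose m := fine ('E_P[fun w => (x w 0 k)%R])%E.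
have mx : measurable_fun setT (fun w => x w 0 k - m).
  exact: measurable_funB.
have -> : (fun w => x w 0 k) = (fun w => x w 0 k - m) \+ cst m.
  by apply/funext => w /=; rewrite subrK.
rewrite rpredD ?lee1n// => le12; last exact: Lfun_cst.
apply: Lfun2P => //.
move: x_var; rewrite /trVar unlock; apply: le_lt_trans.
have mn : measurable_fun setT (fun w => norm2 (x w - mean P x) ^+ 2).
  under eq_fun do rewrite norm2_sqr.
  apply: measurable_sum => l; apply: measurable_funM;
    under eq_fun do rewrite !mxE; exact: measurable_funB.
apply: ge0_le_integral => //.
- by move=> w _; rewrite lee_fin sqr_ge0.
- by apply/measurable_EFinP; exact: measurable_funX.
- exact/measurable_EFinP.
- move=> w _; rewrite lee_fin norm2_sqr /inner (bigD1 k)//= !mxE -expr2.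
  by rewrite lerDl sumr_ge0// => l _; rewrite -expr2 sqr_ge0.
Qed.

Lemma inner_L1 n (x y : T -> 'rV[R]_n) :
  square_integrable x -> square_integrable y ->
  (fun w => inner (x w) (y w)) \in Lfun P 1.
Proof.
move=> x2 y2; rewrite -[X in X \in _]fct_sumE rpred_sum// => k _.
exact: (Lfun2_mul_Lfun1 (x2 k) (y2 k)).
Qed.

Lemma residual_square_integrable n (x : T -> 'rV[R]_n) :
  square_integrable x -> square_integrable (fun w => x w - condMean B x w).
Proof.
move=> x2 k; under eq_fun do rewrite !mxE.
by rewrite rpredB ?lee1n// => le12; exact: condE_L2.
Qed.

Lemma sum_square_integrable n I (s : seq I) (x : I -> T -> 'rV[R]_n) :
  (forall i, square_integrable (x i)) ->
  square_integrable (fun w => \sum_(i <- s) x i w).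
Proof.
move=> x2 k; under eq_fun do rewrite summxE.
by rewrite -[X in X \in _]fct_sumE rpred_sum ?lee1n// => le12 i _; exact: x2.
Qed.

Lemma trCondVarE n (x : T -> 'rV[R]_n) : trCondVar B x = trCondCov B x x.
Proof. by congr condE; apply/funext => w; rewrite norm2_sqr. Qed.

Lemma trCondCov_L1 n (x y : T -> 'rV[R]_n) :
  square_integrable x -> square_integrable y -> trCondCov B x y \in Lfun P 1.
Proof.
by move=> x2 y2; apply/condE_L1/inner_L1; exact: residual_square_integrable.
Qed.

Lemma trCondVar_ge0 n (x : T -> 'rV[R]_n) : square_integrable x ->
  {ae P, forall w, 0 <= trCondVar B x w}.
Proof.
move=> x2; apply: condE_ge0 => [|w]; last exact: sqr_ge0.
under eq_fun do rewrite norm2_sqr.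
by apply: inner_L1; exact: residual_square_integrable.
Qed.

Lemma condMean_sum n I (s : seq I) (x : I -> T -> 'rV[R]_n) :
  (forall i, square_integrable (x i)) ->
  {ae P, forall w, condMean B (fun w' => \sum_(i <- s) x i w') w =
                   \sum_(i <- s) condMean B (x i) w}.
Proof.
move=> x2.
(* With finitely many coordinates, one null set serves them all. *)
have : {ae P, forall w (k : 'I_n),
    condE B (fun w' => \sum_(i <- s) x i w' 0 k) w =
    \sum_(i <- s) condE B (fun w' => x i w' 0 k) w}.
  by apply: filter_forall => k; apply: condE_sum => i; exact/Lfun21/x2.
apply: filterS => w sumw; apply/rowP => k; rewrite mxE summxE.
under eq_fun do rewrite summxE.
by rewrite sumw; apply: eq_bigr => i _; rewrite mxE.
Qed.

Lemma trCondVar_sum n I (s : seq I) (x : I -> T -> 'rV[R]_n) :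
  (forall i, square_integrable (x i)) ->
  {ae P, forall w, trCondVar B (fun w' => \sum_(i <- s) x i w') w =
                   \sum_(i <- s) \sum_(j <- s) trCondCov B (x i) (x j) w}.
Proof.
move=> x2; pose y i w := x i w - condMean B (x i) w.
have y2 i : square_integrable (y i) by exact: residual_square_integrable.
have iyy i j : (fun w => inner (y i w) (y j w)) \in Lfun P 1.
  exact: inner_L1.
have iyy1 i : (fun w => \sum_(j <- s) inner (y i w) (y j w)) \in Lfun P 1.
  by rewrite -[X in X \in _]fct_sumE rpred_sum.
have iyy2 : (fun w => \sum_(i <- s) \sum_(j <- s) inner (y i w) (y j w))
    \in Lfun P 1.
  by rewrite -[X in X \in _]fct_sumE rpred_sum.
have iR : (fun w => inner ((\sum_(i <- s) x i w)
      - condMean B (fun w' => \sum_(i <- s) x i w') w)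
    ((\sum_(i <- s) x i w)
      - condMean B (fun w' => \sum_(i <- s) x i w') w)) \in Lfun P 1.
  by apply: inner_L1; apply/residual_square_integrable/sum_square_integrable.
(* The double sum of covariances is a version for the expanded squared norm of the summed residuals,
   so uniqueness will identify it with the conditional variance of the sum. *)
have sumcov : is_condE B
    (fun w => \sum_(i <- s) \sum_(j <- s) inner (y i w) (y j w))
    (fun w => \sum_(i <- s) \sum_(j <- s) trCondCov B (x i) (x j) w).
  apply: is_condE_sum => // i; apply: is_condE_sum => // j.
  exact: condEP.
rewrite trCondVarE; apply: is_condE_ae_eq (condEP B iR) sumcov _ => //.
have := condMean_sum s x2; apply: filterS => w ->.
by rewrite -sumrB inner_sum.
Qed.

Lemma sqrt_trCondVar_L2 n (x : T -> 'rV[R]_n) : square_integrable x ->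
  (fun w => Num.sqrt (trCondVar B x w)) \in Lfun P 2%:E.
Proof.
move=> x2; have := trCondCov_L1 x2 x2; rewrite -trCondVarE.
move=> /Lfun1_integrable/integrableP[mV Voo].
have mS : measurable_fun setT (fun w => Num.sqrt (trCondVar B x w)).
  apply: (measurableT_comp (continuous_measurable_fun (@sqrt_continuous R))).
  exact/measurable_EFinP.
apply: Lfun2P => //; apply: le_lt_trans Voo.
apply: ge0_le_integral => //.
- by apply/measurable_EFinP; exact: measurable_funX.
- exact: measurableT_comp.
(* The chosen version may be negative on a null set; [Num.sqrt] is 0 there, so the bound by the
   absolute value holds everywhere. *)
- move=> w _; rewrite lee_fin; have [V0|V0] := leP 0 (trCondVar B x w).
    by rewrite sqr_sqrtr// ler_norm.
  by rewrite ler0_sqrtr ?(ltW V0)// expr0n/= normr_ge0.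
Qed.

End trace_covariance.

(** * Integration of the pairwise covariance bounds *)

Theorem lemma2 (d d' : measure_display) (T : measurableType d)
    (T' : measurableType d') (R : realType) (P : probability T R)
    (B : {RV P >-> T'}) (n b : nat) (x : 'I_b -> T -> 'rV[R]_n) (rho : R)
    (x_rv : forall i, random_vector (x i))
    (x_var : forall i, (trVar P (x i) < +oo)%E)
    (rho01 : 0 <= rho <= 1)
    (x_corr : corr_le B x rho) :
  let S := sumCondStd B x in
  let V := sumCondVar B x in
  let lhs := ('E_P[trCondVar B (fun w => (\sum_(i < b) x i w)%R)])%E in
  let rhs := (rho%:E * 'V_P[S] + rho%:E * 'E_P[S] ^+ 2
              + (1 - rho)%:E * 'E_P[V])%E in
  (lhs <= rhs)%E /\ (corr_eq B x rho -> lhs = rhs).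
Proof.
have x2 i : square_integrable P (x i) by exact: trVar_square_integrable.
pose v i := trCondVar B (x i); pose sd i w := Num.sqrt (v i w).
pose cov i j := trCondCov B (x i) (x j).
have cov1 i j : cov i j \in Lfun P 1 by exact: trCondCov_L1.
have v1 i : v i \in Lfun P 1 by rewrite /v trCondVarE; exact: cov1.
have sd2 i : sd i \in Lfun P 2%:E by exact: sqrt_trCondVar_L2.
pose sumcov w := \sum_(i < b) \sum_(j < b) cov i j w.
pose bound w := rho * sumCondStd B x w ^+ 2 + (1 - rho) * sumCondVar B x w.
move=> S V lhs rhs.
have S2 : S \in Lfun P 2%:E.
  by rewrite -[S]fct_sumE rpred_sum ?lee1n// => le12 i _; exact: sd2.
have V1 : V \in Lfun P 1 by rewrite -[V]fct_sumE rpred_sum// => i _; exact: v1.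
have SS1 := Lfun2_sqr S2.
have sumcov1 : sumcov \in Lfun P 1.
  rewrite -[sumcov]fct_sumE rpred_sum// => i _.
  by rewrite -[X in X \in _]fct_sumE rpred_sum// => j _; exact: cov1.
have bound1 : bound \in Lfun P 1.
  by rewrite rpredD ?(rpredZ rho SS1) ?(rpredZ (1 - rho) V1).
have lhsE : lhs = (\int[P]_w (sumcov w)%:E)%E.
  rewrite /lhs unlock; apply: ae_eq_integral => //.
  - have s2 := sum_square_integrable (index_enum 'I_b) x2.
    have := trCondCov_L1 B s2 s2.
    by rewrite -trCondVarE => /Lfun1_integrable/(measurable_int P).
  - by move: sumcov1 => /Lfun1_integrable/(measurable_int P).
  - have := trCondVar_sum B (index_enum 'I_b) x2.
    by apply: filterS => w /= -> _.
have rhsE : rhs = (\int[P]_w (bound w)%:E)%E.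
  (* Finiteness of E[S] justifies factoring out [rho] and cancelling (E S) ^ 2 in the extended
     reals. *)
  have ES := expectation_fin_num (Lfun21 S2).
  have ESS := expectation_fin_num SS1.
  have boundE : (\int[P]_w (bound w)%:E =
      rho%:E * 'E_P[fun w => (S w ^+ 2)%R] + (1 - rho)%:E * 'E_P[V])%E.
    rewrite !unlock -!integralZl//; [|exact/Lfun1_integrable..].
    by rewrite -integralD//; apply/integrableZl => //; exact/Lfun1_integrable.
  rewrite /rhs boundE varianceE// -muleDr ?fin_num_adde_defl ?fin_numX//.
  by rewrite subeK// fin_numX.
(* Spreads [bound] over pairs: where v_i >= 0 the diagonal entry is rho v_i + (1 - rho) v_i = v_i,
   and off the diagonal only the correlation bound remains. *)
pose term i j w := rho * (sd i w * sd j w) + (1 - rho) * (v i w *+ (i == j)).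
have boundE w : bound w = \sum_(i < b) \sum_(j < b) term i j w.
  rewrite /bound expr2 /sumCondStd mulr_suml mulr_sumr.
  rewrite /sumCondVar mulr_sumr -big_split; apply: eq_bigr => i _ /=.
  rewrite big_split/= -mulr_sumr -mulr_sumr -mulr_sumr; congr (_ + _ * _).
  rewrite (bigD1 i)//= eqxx big1 ?addr0// => j ji.
  by rewrite eq_sym (negbTE ji).
have v0 : {ae P, forall w i, 0 <= v i w}.
  by apply: filter_forall => i; exact: trCondVar_ge0.
have diag w i : 0 <= v i w -> cov i i w = term i i w.
  move=> vi0; rewrite /term eqxx -expr2 sqr_sqrtr// /cov -trCondVarE -/(v i).
  by rewrite mulr1n; ring.
have offdiag w i j : i != j -> term i j w = rho * sd i w * sd j w.
  by move=> /negbTE ij; rewrite /term ij mulr0n mulr0 addr0 mulrA.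
rewrite lhsE rhsE; split=> [|x_eq].
  apply: ae_le_integral => //; [exact/Lfun1_integrable..|].
  have le_cov : {ae P, forall w i j,
      i != j -> cov i j w <= rho * sd i w * sd j w}.
    apply: filter_forall => i; apply: filter_forall => j.
    have [->|/x_corr] := eqVneq i j; first exact: aeW.
    by apply: filterS => w ? _.
  apply: filterS2 v0 le_cov => w v0 le_cov _.
  rewrite lee_fin boundE; apply: ler_sum => i _; apply: ler_sum => j _.
  have [<-|ij] := eqVneq i j; first by rewrite diag.
  by rewrite offdiag// le_cov.
(* In the equality case the two integrands agree term by term outside a null set. *)
apply: ae_eq_integral => //.
  exact/(measurable_int P)/Lfun1_integrable.
  exact/(measurable_int P)/Lfun1_integrable.
have eq_cov : {ae P, forall w i j,
    i != j -> cov i j w = rho * sd i w * sd j w}.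
  apply: filter_forall => i; apply: filter_forall => j.
  have [->|/x_eq] := eqVneq i j; first exact: aeW.
  by apply: filterS => w ? _.
apply: filterS2 v0 eq_cov => w v0 eq_cov _; congr EFin.
rewrite boundE; apply: eq_bigr => i _; apply: eq_bigr => j _.
have [<-|ij] := eqVneq i j; first by rewrite diag.
by rewrite offdiag// eq_cov.
Qed.
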